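(* Let $K\ge2$, $n\ge1$, $\alpha\in(0,1)$, and let $\mathcal L_X$ be a continuous (atomless) distribution on a space $\mathcal X$. Let $C$ be a measurable function of data $(X_1,Y_1),\dots,(X_n,Y_n)\in(\mathcal X\times\{1,\dots,K\})^n$ with the following property: for every joint distribution $\mathcal L$ of $(X,Y)$ whose $X$-marginal is $\mathcal L_X$ and whose $Y$-marginal is $\mathrm{Unif}(\{1,\dots,K\})$, if $(X_i,Y_i)_{i=1}^n$ are i.i.d. from $\mathcal L$ then $\mathbb P_{\mathcal L}\big(C(X_{1:n},Y_{1:n})\ge\mathrm{ETV}(X,Y)\big)\ge1-\alpha$. Then, when $(X_i,Y_i)\stackrel{\text{i.i.d.}}{\sim}\mathcal L_X\times\mathrm{Unif}(\{1,\dots,K\})$ (so that $X$ and $Y$ are independent), $$\mathbb P\big(C(X_{1:n},Y_{1:n})\ge1\big)\ge1-\alpha.$$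
   Context: For $(X,Y)\sim\mathcal L$ with $Y\in\{1,\dots,K\}$, $\mathrm{ETV}(X,Y)=\frac{1}{1-1/K}\,\mathbb E_{\mathcal L}\big[\mathrm{TV}(\mathcal L(Y\mid X),\mathcal L(Y))\big]$, where $\mathrm{TV}$ is total variation distance (half the $L_1$ distance). This quantity always lies in $[0,1]$, and $1$ is its theoretical upper bound. *)

(* Defs.v *)
From HB Require Import structures.
From mathcomp Require Import all_boot all_order all_algebra.
From mathcomp Require Import all_classical all_reals.
From mathcomp Require Import ereal topology normedtype sequences measure
  lebesgue_measure lebesgue_integral probability.

Set Implicit Arguments.
Unset Strict Implicit.
Unset Printing Implicit Defensive.

Import Order.TTheory GRing.Theory Num.Theory.
Local Open Scope classical_set_scope.
Local Open Scope ring_scope.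

Definition atomless {d} {T : measurableType d} {R : realType}
  (PX : set T -> \bar R) : Prop :=
  forall A : set T, measurable A -> (0 < PX A)%E ->
    exists B : set T,
      [/\ measurable B, B `<=` A, (0 < PX B)%E & (PX B < PX A)%E].

Definition rect_event {Omega T : Type} {K : nat}
  (X : Omega -> T) (Y : Omega -> 'I_K) (A : set T) (k : 'I_K) : set Omega :=
  X @^-1` A `&` Y @^-1` [set k].

(** A joint law of (X,Y) on T x {1..K} (K finite) is described by the family
    of measures mu k A = L(X \in A, Y = k).
    (X i, Y i)_{i<n} is an i.i.d. sample from that law on the probability
    space (Omega, P): measurable, each pair has law mu, and the pairs are
    mutually independent (product rule on every subfamily, for the
    pi-system generating sigma(X i, Y i)). *)
Definition iid_sample {dO d} {Omega : measurableType dO} {T : measurableType d}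
  {R : realType} {n K : nat} (P : probability Omega R)
  (X : 'I_n -> Omega -> T) (Y : 'I_n -> Omega -> 'I_K)
  (mu : 'I_K -> set T -> \bar R) : Prop :=
  [/\ (forall i, measurable_fun setT (X i)),
      (forall i k, measurable (Y i @^-1` [set k])),
      (forall i A k, measurable A -> P (rect_event (X i) (Y i) A k) = mu k A) &
      (forall (S : {set 'I_n}) (A : 'I_n -> set T) (k : 'I_n -> 'I_K),
         (forall i, measurable (A i)) ->
         P (\bigcap_(i in [set i | i \in S]) rect_event (X i) (Y i) (A i) (k i))
         = (\prod_(i in S) P (rect_event (X i) (Y i) (A i) (k i)))%E)].

Definition data {Omega T : Type} {n K : nat}
  (X : 'I_n -> Omega -> T) (Y : 'I_n -> Omega -> 'I_K) (w : Omega) :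
  'I_n -> T * 'I_K := fun i => (X i w, Y i w).

Definition data_cylinders {d} {T : measurableType d} {n K : nat} :
  set (set ('I_n -> T * 'I_K)) :=
  [set E | exists i A k, measurable A /\
           E = [set z | A (z i).1 /\ (z i).2 = k]].

Definition data_measurable_fun {d} {T : measurableType d} {R : realType}
  {n K : nat} (C : ('I_n -> T * 'I_K) -> R) : Prop :=
  forall B : set R, measurable B ->
    (<<s (@data_cylinders d T n K) >>) (C @^-1` B).

Definition cond_law_version {d} {T : measurableType d} {R : realType} {K : nat}
  (PX : set T -> \bar R) (mu : 'I_K -> set T -> \bar R)
  (p : T -> 'I_K -> R) : Prop :=
  [/\ (forall k, measurable_fun setT (fun x => p x k)),
      (forall x k, 0 <= p x k),
      (forall x, \sum_(k < K) p x k = 1) &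
      (forall k A, measurable A ->
         mu k A = (\int[PX]_(x in A) (p x k)%:E)%E)].

(** ETV(X,Y) = (1 - 1/K)^-1 E[ TV(L(Y|X), L(Y)) ], TV = half L1 distance,
    L(Y = k) = mu k setT. *)
Definition ETV {d} {T : measurableType d} {R : realType} {K : nat}
  (PX : set T -> \bar R) (mu : 'I_K -> set T -> \bar R)
  (p : T -> 'I_K -> R) : \bar R :=
  (((1 - K%:R^-1)^-1)%:E *
   \int[PX]_x (2^-1 * \sum_(k < K) `|p x k - fine (mu k setT)|)%:E)%E.

(* Main.v *)
Require Import Defs.
From HB Require Import structures.
From mathcomp Require Import all_boot all_order all_algebra.
From mathcomp Require Import all_classical all_reals.
From mathcomp Require Import ereal topology normedtype sequences measure
  lebesgue_measure lebesgue_integral probability numfun measurable_realfun.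
From mathcomp Require Import lra.

Import Order.TTheory GRing.Theory Num.Theory.
Local Open Scope classical_set_scope.
Local Open Scope ring_scope.

(** Since [PX] is atomless, [T] splits into [N] blocks of [K] cells each, all
    cells having the same mass.  A vector [s] of cyclic shifts, one per block,
    turns the index of a cell inside its block into a label; the label is a
    function of [X], so the ETV is 1, and it is uniform for every [s], so [C]
    is valid for it.  Average over [s]: when the [X i] fall in distinct blocks,
    their labels are independent and uniform, exactly as under the product law.
    Two of the [X i] share a block with probability at most [n ^ 2 / N], which
    vanishes as [N] grows.  All these laws are realised on the sample space of
    the product law, by replacing [Y i] with the label of [X i]. *)

(** * Probabilities as real numbers *)

Section probability_reals.
Context {R : realType} {d : measure_display} {T : measurableType d}.
Variable P : probability T R.
Local Notation pr A := (fine (P A)).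

Lemma prE A : measurable A -> P A = (pr A)%:E.
Proof. by move=> mA; rewrite fineK// fin_num_measure. Qed.

Lemma pr_ge0 A : 0 <= pr A.
Proof. exact/fine_ge0/measure_ge0. Qed.

Lemma le_pr A B : measurable A -> measurable B -> A `<=` B -> pr A <= pr B.
Proof.
by move=> mA mB AB; rewrite fine_le ?fin_num_measure// le_measure ?inE.
Qed.

Lemma pr_le1 A : measurable A -> pr A <= 1.
Proof. by move=> mA; rewrite -lee_fin -prE// probability_le1. Qed.

Lemma prU A B : measurable A -> measurable B -> A `&` B = set0 ->
  pr (A `|` B) = pr A + pr B.
Proof.
by move=> mA mB AB; rewrite measureU// fineD// fin_num_measure.
Qed.

Lemma prD A B : measurable A -> measurable B -> B `<=` A ->
  pr (A `\` B) = pr A - pr B.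
Proof.
move=> mA mB BA; apply/eqP; rewrite -subr_eq opprK; apply/eqP.
rewrite addrC -prU ?setDUK ?setDIK//; exact: measurableD.
Qed.

Lemma pr_fibers (I : finType) (g : T -> I) A : measurable A ->
  (forall i, measurable (g @^-1` [set i])) ->
  pr A = \sum_i pr (A `&` g @^-1` [set i]).
Proof.
move=> mA mg; apply: EFin_inj; rewrite -prE// EFin_sum_fine => [|i _]; last first.
  by rewrite fin_num_measure//; exact: measurableI.
rewrite [RHS]fsbig_seq ?index_enum_uniq// -measure_fin_bigcup//.
- congr (P _); apply/seteqP; split=> [x Ax|x [i _ []]//].
  by exists (g x) => //=; rewrite mem_index_enum.
- by move=> i j _ _ [x [[_ /= <-] [_ /= <-]]].
- by move=> i _; exact: measurableI.
Qed.

Lemma measurable_fiber (I : finType) (g : T -> I) (B : set I) :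
  (forall i, measurable (g @^-1` [set i])) -> measurable (g @^-1` B).
Proof.
move=> mg; rewrite (_ : g @^-1` B = \bigcup_(i in B) g @^-1` [set i]).
  exact: fin_bigcup_measurable.
by apply/seteqP; split=> [x Bx|x [i Bi /= ->]//]; exists (g x).
Qed.

Lemma pr_le_sum (I : finType) (Q : pred I) (A : set T) (F : I -> set T) :
  measurable A -> (forall i, measurable (F i)) ->
  (A `<=` \bigcup_(i in [set` Q]) F i) ->
  pr A <= \sum_(i | Q i) pr (F i).
Proof.
move=> mA mF AF.
suff [mU leU] : measurable (\big[setU/set0]_(i | Q i) F i) /\
    pr (\big[setU/set0]_(i | Q i) F i) <= \sum_(i | Q i) pr (F i).
  by apply: le_trans leU; apply: le_pr => //; rewrite -bigcup_pred.
apply: (big_ind2 (fun B x => measurable B /\ pr B <= x)) => //.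
- by rewrite measure0.
- move=> B x D y [mB Bx] [mD Dy]; split; first exact: measurableU.
  rewrite -(setDUK (@subsetUl _ B D)) prU ?setDIK//; last exact/measurableD/mB/measurableU.
  rewrite lerD// (le_trans _ Dy)// le_pr//.
  + by apply: measurableD => //; exact: measurableU.
  + by move=> w [[//|]].
Qed.

(** * Atomless probabilities: sets of prescribed mass and equipartitions *)

Lemma atomless_halve A : atomless P -> measurable A -> 0 < pr A ->
  exists B, [/\ measurable B, B `<=` A & 0 < pr B <= pr A / 2].
Proof.
move=> aP mA A0; have [|B [mB BA]] := aP A mA; first by rewrite prE// lte_fin.
rewrite (prE _ mA) (prE _ mB) !lte_fin => B0 ltBA.
(* Of the two pieces [B] and [A \ B], both of positive mass, the lighter one serves. *)
have [leB|ltB] := leP (pr B) (pr A / 2).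
  by exists B; split=> //; rewrite B0.
exists (A `\` B); split; [exact: measurableD|exact: subDsetl|].
by rewrite prD//; lra.
Qed.

(** Repeated halving inside [A] brings the mass below [2 ^ -m], and [2 ^ m] outgrows [1 / e]. *)
Lemma atomless_small A (e : R) : atomless P -> measurable A -> 0 < pr A ->
  0 < e -> exists B, [/\ measurable B, B `<=` A & 0 < pr B <= e].
Proof.
move=> aP mA A0 e0.
have [m] : exists m : nat, (2 ^+ m)^-1 <= e.
  exists (Num.bound e^-1); rewrite -[leRHS]invrK lef_pV2 ?posrE ?exprn_gt0 ?invr_gt0//.
  have /archi_boundP le_e : 0 <= e^-1 by rewrite invr_ge0 ltW.
  apply/ltW/(lt_le_trans le_e).
  by rewrite -natrX ler_nat ltnW// ltn_expl.
suff [B [mB BA /andP[B0 Bm]]] : exists B, [/\ measurable B, B `<=` A &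
    0 < pr B <= (2 ^+ m)^-1].
  by move=> le_me; exists B; split=> //; rewrite B0 (le_trans Bm).
elim: m => [|m [B [mB BA /andP[B0 Bm]]]].
  by exists A; split=> //; rewrite expr0 invr1 A0 pr_le1.
have [D [mD DB /andP[D0 DB2]]] := atomless_halve _ aP mB B0.
exists D; split=> //; first exact: subset_trans BA.
by rewrite D0 (le_trans DB2)// exprS invfM mulrC ler_pM2l ?invr_gt0.
Qed.

(* One greedy step: [B'] gains at least half of what any admissible extension
   of [B] could gain. *)
Lemma greedy_step A (t : R) B : measurable A -> measurable B -> B `<=` A ->
  pr B <= t ->
  exists B', [/\ measurable B', B `<=` B', B' `<=` A, pr B' <= t &
    forall E, measurable E -> E `<=` A `\` B -> pr B + pr E <= t ->
      pr E <= 2 * (pr B' - pr B)].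
Proof.
move=> mA mB BA Bt.
pose S := [set pr E | E in [set E | [/\ measurable E, E `<=` A `\` B &
  pr B + pr E <= t]]].
have S0 : S 0 by exists set0; rewrite ?measure0//=; split=> //; rewrite ?measure0/= ?addr0.
have supS : has_sup S.
  split; first by exists 0.
  by exists 1 => _ [E [mE _ _] <-]; exact: pr_le1.
have leS E : measurable E -> E `<=` A `\` B -> pr B + pr E <= t ->
    pr E <= sup S.
  by move=> mE EAB Et; apply: sup_upper_bound => //; exists E.
(* If no admissible extension has positive mass, [B] itself serves; otherwise some extension has
   more than half of the supremum. *)
have [s0|s0] := leP (sup S) 0.
  exists B; split=> // E mE EAB Et; rewrite subrr mulr0.
  exact: le_trans (leS _ mE EAB Et) s0.
have [|_ [E [mE EAB Et] <-] ltE] := @sup_adherent _ S (sup S / 2) _ supS.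
  by rewrite divr_gt0.
have BE0 : B `&` E = set0.
  by rewrite -subset0 => x [Bx /EAB[]].
have prBE : pr (B `|` E) = pr B + pr E by rewrite prU.
exists (B `|` E); split=> //.
- exact: measurableU.
- by rewrite subUset; split=> // x /EAB[].
- by rewrite prBE.
- move=> F mF FAB Ft; rewrite prBE; have := leS _ mF FAB Ft; lra.
Qed.

(** Sierpinski's theorem on intermediate values. Greedy steps from the empty set increase to a union
    of mass at most [t]. Were that mass below [t], a small set [E] outside the union would remain
    admissible at every step, so the steps would add up to unbounded mass. *)
Lemma atomless_intermediate A (t : R) : atomless P -> measurable A ->
  0 <= t <= pr A -> exists B, [/\ measurable B, B `<=` A & pr B = t].
Proof.
move=> aP mA /andP[t0 tA].
pose inv B := [/\ measurable B, B `<=` A & pr B <= t].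
have /choice[f fP] : forall B, exists B', inv B ->
    [/\ measurable B', B `<=` B', B' `<=` A, pr B' <= t &
    forall E, measurable E -> E `<=` A `\` B -> pr B + pr E <= t ->
      pr E <= 2 * (pr B' - pr B)].
  (* Choice needs a total function: [set0] is a dummy value where the invariant fails. *)
  move=> B; have [[mB BA Bt]|?] := pselect (inv B); last by exists set0.
  by have [B' B'P] := greedy_step _ _ _ mA mB BA Bt; exists B'.
pose F n := iter n f set0.
have invF n : inv (F n).
  elim: n => [|n IH]; first by rewrite /F/=; split=> //; rewrite measure0.
  by have [? ? ? ? _] := fP _ IH; split.
have mF n : measurable (F n) by have [] := invF n.
have FS n : F n `<=` F n.+1 by have [_] := fP _ (invF n).
have mUF : measurable (\bigcup_n F n) by exact: bigcup_measurable.
have UFA : \bigcup_n F n `<=` A by move=> x [n _]; have [_ + _] := invF n; exact.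
have UFt : pr (\bigcup_n F n) <= t.
  rewrite -lee_fin -prE//.
  have ndF : nondecreasing_seq F.
    by apply/nondecreasing_seqP => n; rewrite subsetEset.
  have cF := nondecreasing_cvg_mu (mu := P) mF mUF ndF.
  rewrite -(cvg_lim _ cF)//; apply: lime_le; first by apply/cvg_ex; eexists; exact: cF.
  by apply: nearW => n /=; rewrite prE// lee_fin; have [] := invF n.
exists (\bigcup_n F n); split=> //; apply/eqP; rewrite eq_le UFt leNgt /=.
apply/negP => ltt.
have mD : measurable (A `\` \bigcup_n F n) by exact: measurableD.
have D0 : 0 < pr (A `\` \bigcup_n F n) by rewrite prD// subr_gt0 (lt_le_trans ltt).
have [|E [mE ED /andP[E0 Et]]] := atomless_small _ (t - pr (\bigcup_n F n)) aP mD D0.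
  by rewrite subr_gt0.
(* [E] avoids every [F n] and fits into the gap between the mass of the union and [t], so each
   greedy step gains at least half the mass of [E]. *)
have gain n : pr E <= 2 * (pr (F n.+1) - pr (F n)).
  have [_ _ _ _] := fP _ (invF n); apply=> //.
    by move=> x /ED[Ax Fx]; split=> // Fnx; apply: Fx; exists n.
  apply: le_trans (_ : pr (\bigcup_n F n) + pr E <= t); last lra.
  by rewrite lerD2r le_pr// => x ?; exists n.
have growth n : n%:R * pr E <= 2 * pr (F n).
  elim: n => [|n IH]; first by rewrite mul0r mulr_ge0// pr_ge0.
  by rewrite -natr1 mulrDl mul1r; have := gain n; lra.
(* After more than [2 / pr E] steps the accumulated mass would exceed 1. *)
have /archi_boundP : 0 <= 2 / pr E by rewrite divr_ge0// ltW.
rewrite ltr_pdivrMr// ltNge => /negP; apply.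
by apply: le_trans (growth _) _; have := pr_le1 _ (mF (Num.bound (2 / pr E))); lra.
Qed.

(** Induction on the number of parts: a set [B] of mass [t] becomes part [ord0], and the rest of [A]
    is split into the parts [lift ord0 i]. *)
Lemma atomless_split m A (t : R) : atomless P -> measurable A -> 0 <= t ->
  pr A = m.+1%:R * t -> exists g : T -> 'I_m.+1,
    (forall i, measurable (g @^-1` [set i])) /\
    (forall i, pr (A `&` g @^-1` [set i]) = t).
Proof.
move=> aP mA t0; elim: m A mA => [|m IH] A mA At.
  exists (fun=> ord0); split=> i; rewrite (ord1 i).
    by rewrite preimage_cst mem_set.
  by rewrite preimage_cst mem_set// setIT At mul1r.
have [|B [mB BA Bt]] := atomless_intermediate A t aP mA.
  by rewrite t0 At ler_peMl// ler1n.
have [|g [mg gt]] := IH _ (measurableD mA mB).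
  by rewrite prD// At Bt -[m.+2%:R]natr1 mulrDl mul1r addrK.
pose g' x := if x \in B then ord0 else lift ord0 (g x).
have g'0 : g' @^-1` [set ord0] = B.
  by apply/seteqP; split=> x; rewrite /g' /=; case: ifPn; rewrite ?inE// notin_setE.
have g'S i : g' @^-1` [set lift ord0 i] = ~` B `&` g @^-1` [set i].
  apply/seteqP; split=> x; rewrite /g' /=.
    by case: ifPn; rewrite ?inE// notin_setE => xB /lift_inj.
  by move=> [xB <-]; rewrite memNset.
exists g'; split=> i.
  case: (unliftP ord0 i) => [j|] ->; last by rewrite g'0.
  by rewrite g'S; apply: measurableI => //; exact: measurableC.
case: (unliftP ord0 i) => [j|] ->; last by rewrite g'0 setIidr.
by rewrite g'S setIA -setDE.
Qed.

Lemma atomless_equipartition (I : finType) : atomless P -> (0 < #|I|)%N ->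
  exists g : T -> I, (forall i, measurable (g @^-1` [set i])) /\
    (forall i, pr (g @^-1` [set i]) = #|I|%:R^-1).
Proof.
move=> aP I0.
have [||g [mg gI]] := atomless_split #|I|.-1 setT (#|I|%:R^-1) aP measurableT.
- by rewrite invr_ge0.
- by rewrite probability_setT prednK// divff// pnatr_eq0 -lt0n.
have gE i : (fun x => enum_val (cast_ord (prednK I0) (g x))) @^-1` [set i] =
    g @^-1` [set cast_ord (esym (prednK I0)) (enum_rank i)].
  apply/seteqP; split=> x /=.
    by move=> <-; rewrite enum_valK cast_ordK.
  by move=> ->; rewrite cast_ordKV enum_rankK.
exists (fun x => enum_val (cast_ord (prednK I0) (g x))); split=> i.
  by rewrite gE.
by rewrite gE -[X in P X]setTI.
Qed.

End probability_reals.

(** * Finite products and measurability of data events *)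

Lemma prod_EFin {R : realType} {I : finType} (Q : pred I) (F : I -> R) :
  (\prod_(i | Q i) (F i)%:E)%E = (\prod_(i | Q i) F i)%:E.
Proof. by apply/esym; apply: (big_morph EFin) => // x y; rewrite EFinM. Qed.

(** The sets whose preimage lies in [S] form a sigma-algebra, so cylinders suffice. [S] is kept
    general because it is later both the full sigma-algebra of [Omega] and the smaller one generated
    by the [X i]. *)
Lemma data_preimage {Omega : Type} {d} {T : measurableType d} {n K : nat}
  (S : set (set Omega)) (h : Omega -> 'I_n -> T * 'I_K) :
  sigma_algebra setT S ->
  (forall i A k, measurable A -> S [set w | A (h w i).1 /\ (h w i).2 = k]) ->
  forall G, <<s @data_cylinders d T n K >> G -> S (h @^-1` G).
Proof.
move=> sS hS G; rewrite -[h @^-1` G]setTI; move: G.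
apply: smallest_sub; first exact: sigma_algebra_image.
by move=> _ [i [A [k [mA ->]]]]; rewrite /image_set_system /= setTI; exact: hS.
Qed.

Lemma measurable_ffun_fiber {d} {Omega : measurableType d} {n : nat}
  {J : finType} (Z : 'I_n -> Omega -> J) :
  (forall i j, measurable (Z i @^-1` [set j])) ->
  forall k : {ffun 'I_n -> J},
    measurable ((fun w => [ffun i => Z i w]) @^-1` [set k]).
Proof.
move=> mZ k; rewrite (_ : _ @^-1` _ = \bigcap_i Z i @^-1` [set k i]).
  by apply: fin_bigcap_measurable => // i _; exact: finite_finset.
apply/seteqP; split=> [w /= wk i _|w /= wk]; first by rewrite -wk ffunE.
by apply/ffunP => i; rewrite ffunE; exact: wk.
Qed.

(** * Samples from the product law: label independence and relabelling *)

Section independent_sample.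
Context {R : realType} {n K : nat} {d dO : measure_display}.
Context {T : measurableType d} {Omega : measurableType dO}.
Variables (PX : probability T R) (P : probability Omega R).
Variables (X : 'I_n -> Omega -> T) (Y : 'I_n -> Omega -> 'I_K).
Hypothesis K_gt0 : (0 < K)%N.
Hypothesis sXY : iid_sample P X Y (fun k A => (PX A * (K%:R^-1)%:E)%E).
Local Notation pr A := (fine (P A)).
Local Notation prX A := (fine (PX A)).
Local Notation labels := (fun w => [ffun i => Y i w]).

Definition box (A : 'I_n -> set T) : set Omega :=
  [set w | forall i, A i (X i w)].

Lemma measurable_box A : (forall i, measurable (A i)) -> measurable (box A).
Proof.
move=> mA; rewrite (_ : box A = \bigcap_i X i @^-1` A i).
  apply: fin_bigcap_measurable => // i _.
  by rewrite -[_ @^-1` _]setTI; have [mX _ _ _] := sXY; exact: mX.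
by apply/seteqP; split=> w wA i; [move=> _|]; exact: wA.
Qed.

Lemma measurable_labels k : measurable (labels @^-1` [set k]).
Proof. by have [_ mY _ _] := sXY; exact: measurable_ffun_fiber. Qed.

Lemma pr_box_labels A k : (forall i, measurable (A i)) ->
  pr (box A `&` labels @^-1` [set k]) = K%:R ^- n * \prod_i prX (A i).
Proof.
move=> mA; have [_ _ XYlaw XYind] := sXY.
rewrite (_ : _ `&` _ =
    \bigcap_(i in [set i | i \in [set: 'I_n]%SET]) rect_event (X i) (Y i) (A i) (k i)).
  rewrite XYind// [X in fine X](eq_bigl xpredT) => [|i]; last by rewrite finset.in_setT.
  under eq_bigr => i _ do rewrite XYlaw// prE// -EFinM.
  rewrite prod_EFin /= big_split /= mulrC prodr_const card_ord.
  by rewrite exprVn.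
apply/seteqP; split=> [w [wA /= wk] i _|w wAk].
  by split; [exact: wA|rewrite /= -wk ffunE].
split=> [i|/=]; first by have [] := wAk i (finset.in_setT i).
by apply/ffunP => i; rewrite ffunE; have [] := wAk i (finset.in_setT i).
Qed.

(** Summing [pr_box_labels] over the [K ^ n] label vectors cancels the factor [K ^- n]. *)
Lemma pr_box A : (forall i, measurable (A i)) ->
  pr (box A) = \prod_i prX (A i).
Proof.
move=> mA; rewrite (@pr_fibers _ _ _ _ _ labels); last 2 first.
- exact: measurable_box.
- exact: measurable_labels.
rewrite (eq_bigr (fun=> K%:R ^- n * \prod_i prX (A i))) => [|k _]; last exact: pr_box_labels.
rewrite sumr_const card_ffun !card_ord -[LHS]mulr_natl natrX mulrA divff ?mul1r//.
by rewrite expf_neq0// pnatr_eq0 -lt0n.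
Qed.

Lemma pr_bigcap_preimage (S : {set 'I_n}) A : (forall i, measurable (A i)) ->
  pr (\bigcap_(i in [set i | i \in S]) X i @^-1` A i) = \prod_(i in S) prX (A i).
Proof.
move=> mA; rewrite big_mkcond /=.
(* Padding with the full space outside [S] turns the intersection into a box. *)
rewrite (_ : \bigcap_(i in _) _ = box (fun i => if i \in S then A i else setT)).
  rewrite pr_box => [|i]; last by case: ifP.
  by apply: eq_bigr => i _; case: ifP => // _; rewrite probability_setT.
apply/seteqP; split=> w wA i; last by move=> iS; have := wA i; rewrite iS.
by case: ifPn => // iS; exact: wA.
Qed.

Lemma pr_preimage i A : measurable A -> pr (X i @^-1` A) = prX A.
Proof.
move=> mA; have := pr_bigcap_preimage [set i]%SET (fun=> A) (fun=> mA).
rewrite big_set1 => <-; congr (pr _); apply/seteqP; split=> w.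
  by move=> wA j /=; rewrite inE => /eqP ->.
by apply; rewrite /= inE.
Qed.

(** This is the sigma-algebra on [Omega] generated by the sample [X]. *)
Definition box_algebra : set (set Omega) :=
  <<s [set F | exists2 A, (forall i, measurable (A i)) & F = box A] >>.

Lemma box_algebra_measurable F : box_algebra F -> measurable F.
Proof.
apply: smallest_sub; first exact: sigma_algebra_measurable.
by move=> _ [A mA ->]; exact: measurable_box.
Qed.

(* Equality of the measures [F |-> P (F `&` E)] and [F |-> c P F] propagates
   from the pi-system of boxes to the sigma-algebra it generates. *)
Lemma pr_labels_indep F k : box_algebra F ->
  pr (F `&` labels @^-1` [set k]) = K%:R ^- n * pr F.
Proof.
move=> bF; have c0 : 0 <= K%:R ^- n :> R by rewrite invr_ge0 exprn_ge0.
pose m1 : {measure set Omega -> \bar R} := mrestr P (measurable_labels k).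
pose m2 : {measure set Omega -> \bar R} := mscale (NngNum c0) P.
suff : m1 F = m2 F.
  rewrite /m1 /m2 /= /mrestr /mscale /= => ->.
  by rewrite fineM// fin_num_measure//; exact: box_algebra_measurable.
apply: (@g_sigma_algebra_measure_unique _ _ _ _ _ (fun=> setT)) bF => //.
- by move=> _ [A mA ->]; exact: measurable_box.
- by move=> _; exists (fun=> setT) => //; apply/seteqP.
- by rewrite bigcup_const.
- move=> _ _ [A mA ->] [B mB ->]; exists (fun i => A i `&` B i).
    by move=> i; exact: measurableI.
  apply/seteqP; split=> w; first by move=> [wA wB] i; split.
  by move=> wAB; split=> i; have [] := wAB i.
- move=> _ [A mA ->]; rewrite /m1 /m2 /= /mrestr /mscale /=.
  have mbox := measurable_box _ mA.
  have mboxk := measurableI _ _ mbox (measurable_labels k).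
  by rewrite (prE _ _ mbox) (prE _ _ mboxk) -EFinM pr_box_labels// pr_box.
- by move=> _; rewrite /m1 /= /mrestr setTI ltey_eq fin_num_measure//; exact: measurable_labels.
Qed.

(** Once the labels are frozen at constants, a data event depends on the [X i] alone; this makes
    [pr_labels_indep] applicable to it. A cylinder pulls back to a box with one constrained side, or
    to the empty set if its label disagrees with [k]. *)
Lemma box_algebra_data k G : <<s @data_cylinders d T n K >> G ->
  box_algebra (data X (fun i _ => k i) @^-1` G).
Proof.
move: G; apply: data_preimage; first exact: smallest_sigma_algebra.
move=> i A k' mA; have [kk'|kk'] := eqVneq (k i) k'; last first.
  rewrite (_ : [set w | _] = set0).
    exact: sigma_algebra0.
  by rewrite -subset0 => w [_ /= /eqP]; rewrite (negPf kk').
apply: sub_sigma_algebra; exists (fun j => if j == i then A else setT).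
  by move=> j; case: ifP.
apply/seteqP; split=> w /=.
  by move=> [wA _] j /=; case: eqP => // ->.
by move=> wA; split; [have := wA i; rewrite eqxx|exact: kk'].
Qed.

Lemma measurable_data Z G : (forall i k, measurable (Z i @^-1` [set k])) ->
  <<s @data_cylinders d T n K >> G -> measurable (data X Z @^-1` G).
Proof.
move=> mZ; move: G; apply: data_preimage; first exact: sigma_algebra_measurable.
move=> i A k mA; apply: (@measurableI _ _ (X i @^-1` A) (Z i @^-1` [set k])); last exact: mZ.
by rewrite -[_ @^-1` _]setTI; have [mX _ _ _] := sXY; exact: mX.
Qed.

(** A label computed from [X i] merges into the condition on [X i]: each rectangle event says that
    [X i] lies in [A] intersected with a fiber of [f]. The product rule is then that of the
    [X i]. *)
Lemma relabelled_iid (f : T -> 'I_K)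
  (mf : forall k, measurable (f @^-1` [set k])) :
  iid_sample P X (fun i w => f (X i w)) (fun k => mrestr PX (mf k)).
Proof.
have [mX _ _ _] := sXY.
have mfX i k : measurable ((fun w => f (X i w)) @^-1` [set k]).
  by rewrite -[_ @^-1` _]setTI; exact: (mX i measurableT _ (mf k)).
have rectE i A k : rect_event (X i) (fun w => f (X i w)) A k =
    X i @^-1` (A `&` f @^-1` [set k]) by [].
have law i A k : measurable A ->
    P (rect_event (X i) (fun w => f (X i w)) A k) = PX (A `&` f @^-1` [set k]).
  move=> mA; have mAf := measurableI _ _ mA (mf k).
  rewrite rectE prE ?pr_preimage -?prE//.
  by rewrite -[_ @^-1` _]setTI; exact: mX.
split=> // S A k mA; under [RHS]eq_bigr do rewrite law//.
have mAf i : measurable (A i `&` f @^-1` [set k i]) by exact: measurableI.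
under [RHS]eq_bigr do rewrite prE//.
rewrite prod_EFin -(pr_bigcap_preimage S _ mAf) -prE//.
apply: fin_bigcap_measurable => // i _.
by rewrite -[_ @^-1` _]setTI; exact: mX.
Qed.

End independent_sample.

(** * Labels that are functions of [X]: extremal ETV and conditional law *)

Lemma ETV_deterministic {R : realType} {d} {T : measurableType d} {K : nat}
  (PX : probability T R) (mu : 'I_K -> set T -> \bar R) (f : T -> 'I_K) :
  (2 <= K)%N -> (forall k, mu k setT = (K%:R^-1)%:E) ->
  ETV PX mu (fun x k => (f x == k)%:R) = 1%E.
Proof.
move=> K2 muT; have K0 : (K%:R : R) != 0 by rewrite pnatr_eq0 -lt0n (leq_trans _ K2).
have K1 : (1 - K%:R^-1 : R) != 0.
  by rewrite subr_eq0 eq_sym invr_eq1 pnatr_eq1 gtn_eqF.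
(* The distance of any point mass to the uniform law is half of [(1 - 1/K) + (K - 1)/K], which is
   exactly the inverse of the normalising factor. *)
rewrite /ETV (eq_integral (cst (1 - K%:R^-1)%:E)); last first.
  move=> x _; congr EFin; rewrite (bigD1 (f x))//= eqxx muT /=.
  have Kle1 : (K%:R^-1 : R) <= 1.
    by rewrite invf_le1 ?ler1n ?ltr0n ?(leq_trans _ K2).
  rewrite (eq_bigr (fun=> K%:R^-1)) => [|k kf]; last first.
    by rewrite eq_sym (negPf kf) muT sub0r normrN ger0_norm// invr_ge0.
  rewrite sumr_const cardC1 card_ord ger0_norm ?subr_ge0// -[X in _ + X]mulr_natr.
  rewrite -subn1 natrB ?(leq_trans _ K2)// mulrBr mulVf//; lra.
rewrite integral_cst//.
rewrite (_ : _ [set: T] = 1%E); last exact: (@probability_setT _ _ _ PX).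
by rewrite mule1 -EFinM mulVf.
Qed.

Lemma deterministic_cond_law {R : realType} {d} {T : measurableType d} {K : nat}
  (PX : probability T R) (f : T -> 'I_K)
  (mf : forall k, measurable (f @^-1` [set k])) :
  cond_law_version PX (fun k => mrestr PX (mf k)) (fun x k => (f x == k)%:R).
Proof.
have fE k : (fun x => (f x == k)%:R : R) = \1_(f @^-1` [set k]).
  apply/funext => x; rewrite indicE.
  by case: eqP => fx; [rewrite mem_set|rewrite memNset].
split=> [k|x k|x|k A mA].
- by rewrite fE; exact: measurable_indic.
- by rewrite ler0n.
- rewrite (bigD1 (f x))//= eqxx big1 ?addr0// => k /negPf.
  by rewrite eq_sym => ->.
- under eq_integral do rewrite (congr1 (fun g => g _) (fE k)).
  by rewrite integral_indic// setIC.
Qed.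

(** Injectivity of [j] means that [n] distinct coordinates are fixed and the others are free. The
    product form avoids the truncated difference [#|J| - n]. *)
Lemma card_ffun_prescribed (J V : finType) (n : nat) (j : 'I_n -> J)
  (c : 'I_n -> V) : injective j ->
  (#|[pred s : {ffun J -> V} | [forall i, s (j i) == c i]]| * #|V| ^ n =
   #|V| ^ #|J|)%N.
Proof.
move=> j_inj.
(* The constraint is local to each coordinate: [F x] is a singleton on the image of [j] and
   everything elsewhere. *)
pose F x := [pred v | [forall i, (j i == x) ==> (v == c i)]].
rewrite (eq_card (B := family F)) => [|s]; last first.
  rewrite !inE; apply/forallP/familyP => [sc x|sF i].
    by rewrite inE; apply/forallP => i; apply/implyP => /eqP <-.
  by have := sF (j i); rewrite inE => /forallP/(_ i); rewrite eqxx.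
rewrite card_family foldrE big_image /=.
rewrite -[in RHS]prod_nat_const (bigID (mem (codom j))) [in RHS](bigID (mem (codom j))) /=.
rewrite [X in (X * _ * _)%N]big1 => [|x /codomP[i ->]]; last first.
  rewrite -(card1 (c i)); apply: eq_card => v; rewrite !inE.
  apply/forallP/eqP => [/(_ i)|-> i']; first by rewrite eqxx => /eqP.
  by apply/implyP => /eqP/j_inj ->.
rewrite mul1n mulnC; congr (_ * _)%N.
  rewrite prod_nat_const; congr (_ ^ _)%N.
  by rewrite (card_codom j_inj) card_ord.
apply: eq_bigr => x xj; apply: eq_card => v; rewrite !inE.
apply/forallP => i; apply/implyP => /eqP jx; case/negP: xj.
by rewrite -jx codom_f.
Qed.

(** * Averaging over shift vectors and bounding collisions *)

Section relabelling.
Context {R : realType} {n K N : nat} {d dO : measure_display}.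
Context {T : measurableType d} {Omega : measurableType dO}.
Variables (PX : probability T R) (P : probability Omega R).
Variables (X : 'I_n -> Omega -> T) (Y : 'I_n -> Omega -> 'I_K.+1).
Hypothesis sXY : iid_sample P X Y (fun k A => (PX A * (K.+1%:R^-1)%:E)%E).
Local Notation pr A := (fine (P A)).
Local Notation prX A := (fine (PX A)).
Local Notation cell := ('I_N * 'I_K.+1)%type.
Variable g : T -> cell.
Hypothesis mg : forall u, measurable (g @^-1` [set u]).

(** A cell is a pair of block and index within the block; addition in ['I_K.+1] is modulo [K.+1],
    hence a cyclic shift. *)
Definition relabel (s : {ffun 'I_N -> 'I_K.+1}) (u : cell) : 'I_K.+1 :=
  u.2 + s u.1.

Definition cells (w : Omega) : {ffun 'I_n -> cell} := [ffun i => g (X i w)].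

Definition collision : set {ffun 'I_n -> cell} :=
  [set z | ~~ injectiveb (fun i => (z i).1)].

Lemma measurable_relabel s k : measurable ((relabel s \o g) @^-1` [set k]).
Proof. exact: (measurable_fiber _ g (relabel s @^-1` [set k])). Qed.

Lemma measurable_cells z : measurable (cells @^-1` [set z]).
Proof.
apply: measurable_ffun_fiber => i u; have [mX _ _ _] := sXY.
by rewrite -[_ @^-1` _]setTI; exact: (mX i measurableT _ (mg u)).
Qed.

(** With distinct blocks, each label [k i] prescribes one value of [s], namely [k i - (z i).2], at
    its own block. So every label vector arises from the same fraction of the shifts. *)
Lemma card_relabel (z : {ffun 'I_n -> cell}) (k : {ffun 'I_n -> 'I_K.+1}) :
  injective (fun i => (z i).1) ->
  #|[pred s | [ffun i => relabel s (z i)] == k]|%:R =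
    K.+1%:R ^+ N * K.+1%:R ^- n :> R.
Proof.
move=> zinj; rewrite (eq_card (B := [pred s : {ffun _} |
    [forall i, s (z i).1 == k i - (z i).2]])) => [|s]; last first.
  rewrite !inE; apply/eqP/forallP => [<- i|sz].
    by rewrite ffunE /relabel addrC addKr.
  by apply/ffunP => i; rewrite ffunE /relabel (eqP (sz i)) addrC subrK.
apply: (mulIf (_ : K.+1%:R ^+ n != 0)); first by rewrite expf_neq0// pnatr_eq0.
rewrite divfK ?expf_neq0 ?pnatr_eq0//.
have := card_ffun_prescribed _ _ _ _ (fun i => k i - (z i).2) zinj.
by rewrite !card_ord => /(congr1 (fun m => m%:R : R)); rewrite natrM !natrX.
Qed.

Lemma relabel_average (G : set ('I_n -> T * 'I_K.+1)) (p : R) :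
  <<s @data_cylinders d T n K.+1 >> G ->
  (forall s, p <= pr (data X (fun i w => relabel s (g (X i w))) @^-1` G)) ->
  p <= pr (data X Y @^-1` G) + pr (cells @^-1` collision).
Proof.
move=> sG pE; have [mX mY _ _] := sXY.
have mXY : measurable (data X Y @^-1` G) by exact: (measurable_data _ _ _ _ sXY).
have mcoll : measurable (cells @^-1` collision).
  exact: (measurable_fiber _ _ _ measurable_cells).
pose labelled (k : {ffun 'I_n -> 'I_K.+1}) := data X (fun i _ => k i) @^-1` G.
have slab k : box_algebra X (labelled k) by exact: box_algebra_data.
have mlab k : measurable (labelled k).
  exact: (box_algebra_measurable _ _ _ _ sXY).
(* Given the cell vector [z], the shifted labels are constants, so each relabelled event decomposes
   into these terms. *)
pose a k z := pr (labelled k `&` cells @^-1` [set z]).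
have scell z k : box_algebra X (labelled k `&` cells @^-1` [set z]).
  have cellE : cells @^-1` [set z] = box X (fun i => g @^-1` [set z i]).
    apply/seteqP; split=> [w /= <- i|w wz]; first by rewrite /= ffunE.
    by apply/ffunP => i; rewrite ffunE; exact: wz.
  have [_ _ _ sI] := (sigma_algebraP (fun A _ => @subsetT _ A)).1
    (smallest_sigma_algebra setT
      [set F | exists2 A, (forall i, measurable (A i)) & F = box X A]).
  apply: sI; first exact: slab.
  by rewrite cellE; apply: sub_sigma_algebra; exists (fun i => g @^-1` [set z i]).
pose good (z : {ffun 'I_n -> cell}) := injectiveb (fun i => (z i).1).
(* Cell vectors with a collision are bounded by their own mass, uniformly in [s]. *)
have bound s : p <= \sum_(z | good z) a [ffun i => relabel s (z i)] z +
    pr (cells @^-1` collision).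
  apply: le_trans (pE s) _.
  have mE : measurable (data X (fun i w => relabel s (g (X i w))) @^-1` G).
    apply: (measurable_data _ _ _ _ sXY) => // i k.
    rewrite -[_ @^-1` _]setTI.
    exact: (mX i measurableT _ (measurable_relabel s k)).
  rewrite (pr_fibers P _ _ _ mE measurable_cells) (bigID good) /=.
  apply: lerD.
    apply: ler_sum => z _; apply: le_pr.
    - by apply: measurableI => //; exact: measurable_cells.
    - by apply: measurableI => //; exact: measurable_cells.
    - move=> w [wG /= wz]; split=> //=; rewrite /labelled /=.
      move: wG; rewrite /= /data -wz; congr G; apply/funext => i.
      by rewrite !ffunE.
  rewrite (pr_fibers P _ _ _ mcoll measurable_cells) [leRHS](bigID good) /=.
  rewrite ler_wpDl ?sumr_ge0// => [z _|]; first exact: pr_ge0.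
  apply: ler_sum => z zbad; apply: le_pr.
  - by apply: measurableI => //; exact: measurable_cells.
  - by apply: measurableI => //; exact: measurable_cells.
  - by move=> w [_ /= wz]; split=> //=; rewrite /collision /= wz.
(* Grouping the shifts by the label vector they produce gives each [k] weight [K.+1 ^ (N - n)],
   matching the uniform labels of the product law. *)
have avg z : good z -> \sum_s a [ffun i => relabel s (z i)] z =
    K.+1%:R ^+ N * pr (data X Y @^-1` G `&` cells @^-1` [set z]).
  move=> /injectiveP zinj.
  rewrite (partition_big (fun s => [ffun i => relabel s (z i)]) xpredT)//=.
  have mXYz := measurableI _ _ mXY (measurable_cells z).
  rewrite (pr_fibers P _ _ _ mXYz (measurable_labels _ _ _ _ sXY)) mulr_sumr.
  apply: eq_bigr => k _.
  rewrite (eq_bigr (fun=> a k z)) => [|s /eqP -> //].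
  rewrite sumr_const -[LHS]mulr_natl.
  rewrite (_ : #|_|%:R = K.+1%:R ^+ N * K.+1%:R ^- n); last first.
    by rewrite -(card_relabel _ k zinj); congr (_%:R); exact: eq_card.
  rewrite -mulrA; congr (_ * _).
  (* The factor [K.+1 ^- n] is the probability of the label vector [k], independent of events
     determined by [X]. *)
  have /esym -> := pr_labels_indep _ _ _ _ (ltn0Sn K) sXY _ k (scell z k); congr (pr _).
  apply/seteqP; split=> w [[wG wz] /= wk]; (split; [split=> //|exact: wk]).
    move: wG; rewrite /labelled /= /data -wk; congr G; apply/funext => i.
    by rewrite ffunE.
  move: wG; rewrite /labelled /= /data -wk; congr G; apply/funext => i.
  by rewrite ffunE.
have KN : 0 < K.+1%:R ^+ N :> R by rewrite exprn_gt0// ltr0n.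
rewrite -(ler_pM2l KN).
have : \sum_(s : {ffun 'I_N -> 'I_K.+1}) p <=
    \sum_s (\sum_(z | good z) a [ffun i => relabel s (z i)] z +
            pr (cells @^-1` collision)).
  by apply: ler_sum => s _; exact: bound.
rewrite sumr_const card_ffun !card_ord -[leLHS]mulr_natl natrX => /le_trans; apply.
rewrite big_split /= sumr_const card_ffun !card_ord -[X in _ + X]mulr_natl natrX.
rewrite mulrDr lerD2r exchange_big /= (eq_bigr _ avg) -mulr_sumr ler_pM2l//.
rewrite (pr_fibers P _ _ _ mXY measurable_cells) [leRHS](bigID good) /= lerDl.
by apply: sumr_ge0 => z _; exact: pr_ge0.
Qed.

Hypothesis gE : forall u, prX (g @^-1` [set u]) = (N * K.+1)%:R^-1.

Lemma pr_cells (B : pred cell) :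
  prX (g @^-1` [set` B]) = #|B|%:R / (N * K.+1)%:R.
Proof.
rewrite (pr_fibers PX _ _ _ (measurable_fiber _ _ _ mg) mg).
rewrite (bigID B) /= [X in _ + X]big1 ?addr0 => [|u /negP uB]; last first.
  rewrite (_ : _ `&` _ = set0) ?measure0// -subset0 => x [/= + xu].
  by rewrite xu.
rewrite (eq_bigr (fun=> (N * K.+1)%:R^-1)) => [|u uB].
  by rewrite sumr_const mulr_natl.
by rewrite -(gE u) setIidr// => x /= ->.
Qed.

Lemma pr_block (j : 'I_N) : prX (g @^-1` [set u | u.1 == j]) = N%:R^-1.
Proof.
have inj_f : injective (fun l : 'I_K.+1 => (j, l)) by move=> ? ? [].
rewrite (pr_cells [pred u | u.1 == j]).
rewrite (_ : #|_| = K.+1).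
  by rewrite natrM invfM mulrCA divff ?mulr1// pnatr_eq0.
rewrite -[RHS]card_ord -(card_codom inj_f); apply: eq_card => -[j' l].
rewrite !inE /=; apply/eqP/codomP => [->|[l' [-> _]]//].
by exists l.
Qed.

(** Each block [j] has exactly one cell labelled [k], the one of index [k - s j], so [N] of the
    [N * K.+1] equal cells carry that label. *)
Lemma relabel_uniform s k : (0 < N)%N ->
  prX ((relabel s \o g) @^-1` [set k]) = K.+1%:R^-1.
Proof.
move=> N0; have inj_f : injective (fun j : 'I_N => (j, k - s j)) by move=> ? ? [].
rewrite (_ : _ @^-1` _ = g @^-1` [set u | relabel s u == k]); last first.
  by apply/seteqP; split=> x /= /eqP.
rewrite (pr_cells [pred u | relabel s u == k]) (_ : #|_| = N).
  by rewrite natrM invfM mulrA divff ?mul1r// pnatr_eq0 -lt0n.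
rewrite -[RHS]card_ord -(card_codom inj_f); apply: eq_card => -[j l].
rewrite !inE /relabel /=; apply/eqP/codomP => [<-|[j' [-> ->]]].
  by exists j; rewrite addrK.
by rewrite subrK.
Qed.

(** Union bound over pairs of distinct indices and a common block: at most [n * n * N] events, each
    of probability [N ^ -2] by independence. *)
Lemma pr_collision : (0 < N)%N ->
  pr (cells @^-1` collision) <= n%:R ^+ 2 / N%:R.
Proof.
move=> N0; have [mX _ _ _] := sXY.
have mblock j : measurable (g @^-1` [set u | u.1 == j]).
  exact: measurable_fiber.
pose both (u : 'I_n * 'I_n * 'I_N) :=
  \bigcap_(i in [set i | i \in [set u.1.1; u.1.2]%SET])
    X i @^-1` (g @^-1` [set v | v.1 == u.2]).
have mboth u : measurable (both u).
  apply: fin_bigcap_measurable => // i _.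
  by rewrite -[_ @^-1` _]setTI; exact: (mX i measurableT _ (mblock _)).
apply: (@le_trans _ _ (\sum_(u | u.1.1 != u.1.2) pr (both u))).
  apply: pr_le_sum => //.
    exact: (measurable_fiber _ _ _ measurable_cells).
  move=> w /= /injectivePn[i [i' ii' zz]].
  exists (i, i', (cells w i).1) => // h /=.
  by rewrite !inE => /orP[]/eqP ->; [|rewrite zz]; rewrite ffunE.
rewrite (eq_bigr (fun=> N%:R^-1 * N%:R^-1)) => [|u uu]; last first.
  rewrite (pr_bigcap_preimage _ _ _ _ _ sXY) => [|//|i]; last exact: mblock.
  by rewrite big_setU1 ?inE//= big_set1 !pr_block.
rewrite sumr_const -[leLHS]mulr_natr.
apply: (@le_trans _ _ (N%:R^-1 * N%:R^-1 * (n * n * N)%:R)).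
  apply: ler_wpM2l; first by rewrite mulr_ge0// invr_ge0.
  rewrite ler_nat (leq_trans (max_card _))// !card_prod !card_ord//.
rewrite !natrM [leLHS]mulrC mulrA mulfK ?expr2//.
by rewrite pnatr_eq0 -lt0n.
Qed.

End relabelling.

(** * Choice of the number of blocks and use of validity for every shift *)

Theorem theorem3 (R : realType) (K n : nat) (alpha : R)
  (d : measure_display) (T : measurableType d) (PX : probability T R)
  (C : ('I_n -> T * 'I_K) -> R) :
  (2 <= K)%N -> (1 <= n)%N -> 0 < alpha < 1 ->
  atomless PX ->
  data_measurable_fun C ->
  (* validity of C over all joint laws with X-marginal PX, Y-marginal uniform *)
  (forall (mu : 'I_K -> {measure set T -> \bar R}) (p : T -> 'I_K -> R),
     (forall A, measurable A -> (\sum_(k < K) mu k A)%E = PX A) ->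
     (forall k, mu k setT = (K%:R^-1)%:E) ->
     cond_law_version PX (fun k => mu k) p ->
     forall (dO : measure_display) (Omega : measurableType dO)
            (P : probability Omega R)
            (X : 'I_n -> Omega -> T) (Y : 'I_n -> Omega -> 'I_K),
       iid_sample P X Y (fun k => mu k) ->
       ((1 - alpha)%:E <=
          P [set w | (ETV PX (fun k => mu k) p <= (C (data X Y w))%:E)%E])%E) ->
  (* conclusion under the independent law PX x Unif{1..K} *)
  forall (dO : measure_display) (Omega : measurableType dO)
         (P : probability Omega R)
         (X : 'I_n -> Omega -> T) (Y : 'I_n -> Omega -> 'I_K),
    iid_sample P X Y (fun k A => (PX A * (K%:R^-1)%:E)%E) ->
    ((1 - alpha)%:E <= P [set w | (1 <= C (data X Y w))%R])%E.
Proof.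
case: K C => [//|K] C K2 _ _ aPX mC validC dO Omega P X Y sXY.
pose G := C @^-1` [set r | 1 <= r].
have sG : <<s @data_cylinders d T n K.+1 >> G.
  apply: mC; rewrite (_ : [set r | _] = `[1, +oo[%classic).
    exact: measurable_itv.
  by apply/seteqP; split=> r /=; rewrite in_itv /= andbT.
have [mX mY _ _] := sXY.
have mXY : measurable (data X Y @^-1` G) by exact: (measurable_data _ _ _ _ sXY).
rewrite (_ : [set w | _] = data X Y @^-1` G)// (prE _ _ mXY) lee_fin.
apply/ler_addgt0Pr => e e0.
have [N N0 leN] : exists2 N, (0 < N)%N & n%:R ^+ 2 / N%:R <= e.
  exists (Num.bound (n%:R ^+ 2 / e)).+1 => //.
  rewrite ler_pdivrMr ?ltr0n// mulrC -ler_pdivrMr//.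
  have /archi_boundP/ltW/le_trans : 0 <= n%:R ^+ 2 / e.
    by rewrite divr_ge0 ?exprn_ge0// ltW.
  by apply; rewrite ler_nat.
have [|g [mg gE]] := atomless_equipartition _ ('I_N * 'I_K.+1)%type aPX.
  by rewrite card_prod !card_ord muln_gt0 N0.
rewrite card_prod !card_ord in gE.
apply: le_trans (_ : _ <= fine (P (data X Y @^-1` G)) + fine (P (cells X g @^-1` collision))) _.
  apply: (relabel_average _ _ _ _ sXY _ mg _ _ sG) => s.
  pose f := relabel s \o g.
  have mf : forall k, measurable (f @^-1` [set k]) by exact: measurable_relabel.
  (* The joint law of [X] and its label [f X]. *)
  pose mu k : {measure set T -> \bar R} := mrestr PX (mf k).
  have muT k : mu k setT = (K.+1%:R^-1)%:E.
    by rewrite /mu /= /mrestr setTI (prE _ _ (mf k)) (relabel_uniform _ _ mg gE).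
  have mE : measurable (data X (fun i w => f (X i w)) @^-1` G).
    apply: (measurable_data _ _ _ _ sXY) => // i k.
    rewrite -[_ @^-1` _]setTI; exact: (mX i measurableT _ (mf k)).
  rewrite -lee_fin -prE//.
  have := validC mu (fun x k => (f x == k)%:R) _ muT
    (deterministic_cond_law PX f mf) _ _ P X (fun i w => f (X i w))
    (relabelled_iid _ _ _ _ (ltn0Sn K) sXY f mf).
  rewrite (ETV_deterministic PX _ f K2 muT) => validE.
  (* What remains is the [X]-marginal of [mu]: the fibers of [f] partition [A]. *)
  apply: validE => A mA.
  rewrite (prE _ _ mA) (pr_fibers _ _ f _ mA mf) -sumEFin.
  by apply: eq_bigr => k _; rewrite -prE//; exact: measurableI.
by rewrite lerD2l (le_trans _ leN)//; exact: (pr_collision _ _ _ _ sXY).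
Qed.
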